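(* Let $F$ be a forest. Then $\chi_{\mathrm{g}}(F)\le 3$ if there exists a vertex $b$ of $F$ such that, once $b$ becomes colored, every trunk $R'$ of the reduced graph $\mathcal{R}'(F)$ satisfies one of: (i) $R'$ has exactly one colored vertex and contains no edge of $E_{>>2}(\mathcal{R}'(F))$; or (ii) $R'$ has no colored vertices and there exists a vertex $v\in V(R')$ that covers $E_{>>2}(R')$.
   Context: $\chi_{\mathrm{g}}(G)$ is the least $t$ such that Alice has a winning strategy in the $t$-coloring game on $G$: Alice and Bob alternate turns, Alice first, coloring uncolored vertices with colors from a $t$-set so that no vertex gets a color used on a neighbor; Bob wins if some uncolored vertex has no available color, Alice wins if all vertices get colored. For a partially colored forest $F$, a trunk of $F$ is a maximal connected subgraph $R$ such that every colored vertex of $R$ is a leaf of $R$; $\mathcal{R}(F)$ is the partially colored forest formed by the disjoint union of all trunks of $F$ (a colored vertex lying in several trunks appears as a separate colored copy in each). For a graph $G$, $E_{>2}(G)$ is the set of edges $xy$ with $d_G(x)>2$ or $d_G(y)>2$, and $E_{>>2}(G)$ the set of edges $xy$ with $d_G(x)>2$ and $d_G(y)>2$. The reduced graph is $\mathcal{R}'(F)=\mathcal{R}(F)-\{xy: xy\notin E_{>2}(\mathcal{R}(F))\}$; its trunks are defined as for any partially colored forest. A vertex $v$ covers a set of edges if $v$ is an endpoint of every edge in the set. *)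

(* Defs.v *)
From mathcomp Require Import all_boot.
Set Implicit Arguments. Unset Strict Implicit. Unset Printing Implicit Defensive.

(* A simple graph is a symmetric irreflexive relation e on a finType. *)
Definition forest (T : finType) (e : rel T) : Prop :=
  forall s : seq T, uniq s -> 3 <= size s -> ~~ cycle e s.

Definition deg (V : finType) (e : rel V) (x : V) : nat := #|[set y | e x y]|.
Definition E_gt2 (V : finType) (e : rel V) : rel V :=
  fun x y => e x y && ((2 < deg e x) || (2 < deg e y)).
Definition E_ggt2 (V : finType) (e : rel V) : rel V :=
  fun x y => [&& e x y, 2 < deg e x & 2 < deg e y].

Section Game.
Variables (T : finType) (e : rel T) (t : nat).

Definition coloring := {ffun T -> option 'I_t}.
Definition available (c : coloring) (v : T) (k : 'I_t) : bool :=
  [forall u, e v u ==> (c u != Some k)].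
Definition complete (c : coloring) : bool := [forall v, c v != None].
Definition stuck (c : coloring) : bool :=
  [exists v, (c v == None) && [forall k, ~~ available c v k]].
Definition legal (c : coloring) (v : T) (k : 'I_t) : bool :=
  (c v == None) && available c v k.
Definition recolor (c : coloring) (v : T) (k : 'I_t) : coloring :=
  [ffun u => if u == v then Some k else c u].

(* alice_wins_from c : Alice to move in position c, she can force a win.
   bob_loses_from c : Bob to move in position c, Alice can force a win. *)
Inductive alice_wins_from : coloring -> Prop :=
| AW_done c : complete c -> alice_wins_from c
| AW_move c v k : ~~ stuck c -> legal c v k ->
    bob_loses_from (recolor c v k) -> alice_wins_from c
with bob_loses_from : coloring -> Prop :=
| BL_done c : complete c -> bob_loses_from c
| BL_all c : ~~ stuck c ->
    (forall v k, legal c v k -> alice_wins_from (recolor c v k)) ->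
    bob_loses_from c.

Definition alice_wins : Prop := alice_wins_from [ffun _ => None].
End Game.

(* chi_g(G) <= k  iff  Alice wins the t-coloring game for some t <= k
   (chi_g is the LEAST such t). *)
Definition game_chromatic_le (T : finType) (e : rel T) (k : nat) : Prop :=
  exists2 t, t <= k & alice_wins e t.

Section Trunks.
Variables (V : finType) (e : rel V) (col : {set V}).

(* A subgraph is a pair (vertex set, edge set); edges are stored as ordered
   pairs, symmetrically. *)
Definition subgraph_of (p : {set V} * {set (V * V)}) : bool :=
  [forall x, forall y, ((x, y) \in p.2) ==>
     [&& e x y, (y, x) \in p.2, x \in p.1 & y \in p.1]].
Definition sdeg (E : {set (V * V)}) (x : V) : nat := #|[set y | (x, y) \in E]|.
Definition sconnected (p : {set V} * {set (V * V)}) : bool :=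
  [forall x in p.1, forall y in p.1, connect (fun u v => (u, v) \in p.2) x y].
Definition pre_trunk (p : {set V} * {set (V * V)}) : bool :=
  [&& subgraph_of p, p.1 != set0, sconnected p &
      [forall x in p.1 :&: col, sdeg p.2 x == 1]].
Definition is_trunk (p : {set V} * {set (V * V)}) : bool :=
  pre_trunk p &&
  [forall q, [&& pre_trunk q, p.1 \subset q.1 & p.2 \subset q.2] ==> (q == p)].

(* R(F): disjoint union of all trunks; a vertex is a pair (trunk, vertex). *)
Definition RV : Type :=
  {p : ({set V} * {set (V * V)}) * V | is_trunk p.1 && (p.2 \in p.1.1)}.
Definition R_edge : rel RV := fun u v =>
  ((val u).1 == (val v).1) && (((val u).2, (val v).2) \in (val u).1.2).
Definition R_col : {set RV} := [set u | (val u).2 \in col].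
Definition R'_edge : rel RV := E_gt2 R_edge.
End Trunks.
Arguments RV {V} e col.
Arguments R_edge {V} e col.
Arguments R_col {V} e col.
Arguments R'_edge {V} e col.

Definition reduced_trunks_ok (T : finType) (e : rel T) (col : {set T}) : Prop :=
  forall P : {set RV e col} * {set (RV e col * RV e col)},
    is_trunk (R'_edge e col) (R_col e col) P ->
    (#|P.1 :&: R_col e col| = 1 /\
     forall x y, (x, y) \in P.2 -> ~~ E_ggt2 (R'_edge e col) x y)
    \/
    (P.1 :&: R_col e col = set0 /\
     exists2 v, v \in P.1 &
       forall x y, (x, y) \in P.2 -> 2 < sdeg P.2 x -> 2 < sdeg P.2 y ->
                   (v == x) || (v == y)).

(* Main.v *)
Require Import Defs.
From mathcomp Require Import all_boot.

(** Alice opens at [b] and keeps the following invariant after each of her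
    moves.  A vertex of degree at most 2 always has a free color, so only heavy
    vertices (degree > 2) matter.  In every component of uncolored vertices,
    where edges between two light vertices are dropped, either (A) no two heavy
    vertices are adjacent and there is at most one pair [(x, k)] such that the
    heavy vertex [x] has a neighbor colored [k], or (B) there is no such pair and
    some vertex [v] covers all heavy-heavy edges.  Several neighbors of [x] with
    the same color count once: this is weaker than condition (i), and it is what
    makes the invariant maintainable.

    Suppose Bob colors [u] with [k].  As the graph is a forest, each new component
    gains at most one pair [(x, k)], so only one can break the invariant.  In case
    (A) it contains the old pair [(x0, k0)], and Alice colors [x0].  In case (B)
    it contains [v] and a heavy neighbor [x] of [u].  If [x = v], Alice colors
    [v]; if [x] and [v] are adjacent, she gives [v] the color [k] of [u], so that
    [x] still sees one color; otherwise she colors [x], whose neighbors in the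
    component are all light. *)

Set Implicit Arguments.
Unset Strict Implicit.
Unset Printing Implicit Defensive.

(** Two distinct neighbors of [u] joined by a path that avoids [u] would close up with [u] to a
    cycle. Later [h] is the adjacency inside the components left once [u] is colored. *)
Lemma forest_unique_neighbor (T : finType) (e h : rel T) (u x y : T) :
    symmetric e -> forest e -> subrel h e ->
    (forall a a', h a a' -> (a != u) && (a' != u)) ->
  e u x -> e u y -> connect h x y -> x = y.
Proof.
move=> e_sym e_forest h_e h_u eux euy /connectP[p0 p0P y_def].
case: (shortenP p0P) y_def => p pP p_uniq _ y_def.
have [//|xNy] := eqVneq x y; exfalso.
have p_neq0 : p != [::] by apply: contra_neq xNy => p0'; rewrite y_def p0'.
have uNp : u \notin x :: p.
  case: p pP p_neq0 {p_uniq y_def} => //= a p /andP[hxa hp] _.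
  have /andP[xu au] := h_u _ _ hxa.
  rewrite !inE negb_or eq_sym xu negb_or eq_sym au /=.
  elim: p a hp {hxa au} => //= a' p IHp a /andP[haa' hp].
  have /andP[_ a'u] := h_u _ _ haa'.
  by rewrite inE negb_or eq_sym a'u (IHp _ hp).
have s_uniq : uniq (u :: x :: p) by rewrite cons_uniq uNp.
have s_cycle : cycle e (u :: x :: p).
  rewrite /cycle rcons_path [last _ _]/= -y_def e_sym euy andbT /= eux.
  exact: sub_path h_e _ _ pP.
have := e_forest _ s_uniq; rewrite s_cycle.
by case: p p_neq0 {pP p_uniq y_def uNp s_uniq s_cycle} => // a p _ /(_ isT).
Qed.

(** * The invariant and the count of free colors *)

Section Strategy.
Variables (T : finType) (e : rel T).
Hypotheses (e_sym : symmetric e) (e_forest : forest e).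

Notation coloring := (coloring T 3).
Implicit Types (c : coloring) (r u v x y z : T) (k : 'I_3).

Definition heavy x := 2 < deg e x.

(* The classes of [conn] on uncolored vertices are the uncolored parts of the
   trunks of the reduced graph. *)
Definition link c : rel T :=
  fun x y => [&& e x y, c x == None, c y == None & heavy x || heavy y].

Definition conn c : rel T := connect (link c).

Definition seen c x k := [&& c x == None, heavy x & ~~ available e c x k].

Definition hh c x y := [&& e x y, c x == None, c y == None, heavy x & heavy y].

(* [tame] and [covered] are the alternatives (A) and (B) for the component
   of [r]. *)
Definition tame c r :=
  (forall x y, conn c r x -> ~~ hh c x y) /\
  (forall x x' k k', conn c r x -> conn c r x' ->
     seen c x k -> seen c x' k' -> x = x' /\ k = k').

Definition covered c r :=
  (forall x k, conn c r x -> ~~ seen c x k) /\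
  exists v, forall x y, conn c r x -> hh c x y -> v = x \/ v = y.

Definition good c r := tame c r \/ covered c r.

Lemma link_sym c : symmetric (link c).
Proof. by move=> x y; rewrite /link e_sym orbC; do 2!case: (c _ == None). Qed.

Lemma conn_sym c : symmetric (conn c).
Proof. exact: sym_connect_sym (@link_sym c). Qed.

Lemma hh_sym c : symmetric (hh c).
Proof.
move=> x y; rewrite /hh e_sym [heavy x && _]andbC.
by do 2!case: (c _ == None).
Qed.

Lemma hh_conn c x y : hh c x y -> conn c x y.
Proof.
by case/and5P=> exy cx cy hx _; apply: connect1; rewrite /link exy cx cy hx.
Qed.

Lemma availablePn c x k :
  reflect (exists2 y, e x y & c y = Some k) (~~ available e c x k).
Proof.
apply: (iffP forallPn) => [[y]|[y exy cy]].
  by rewrite negb_imply negbK => /andP[exy /eqP]; exists y.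
by exists y; rewrite exy cy eqxx.
Qed.

(** If all three colors were blocked, sending each neighbor to its color would map at most two
    vertices onto them. The default [ord0] only makes this map total. *)
Lemma available_light c x : ~~ heavy x -> exists k, available e c x k.
Proof.
rewrite /heavy -leqNgt => xlight; apply/existsP; apply: contraLR xlight.
move=> /existsPn allN; rewrite -ltnNge.
have -> : 2 < deg e x = (#|'I_3| <= deg e x) by rewrite card_ord.
apply: leq_trans (leq_imset_card (fun y => odflt ord0 (c y)) _).
apply/subset_leq_card/subsetP => k _; apply/imsetP.
by have /availablePn[y exy cy] := allN k; exists y; rewrite ?inE // cy.
Qed.

Lemma available_heavy c x k0 k1 :
    (forall k, ~~ available e c x k -> k = k0 \/ k = k1) ->
  exists k, available e c x k.
Proof.
move=> two; apply/existsP; apply: contraT => /existsPn allN.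
have : #|'I_3| <= #|[set k0; k1]|.
  apply/subset_leq_card/subsetP => k _; rewrite !inE.
  by have [->|->] := two k (allN k); rewrite eqxx ?orbT.
by rewrite card_ord cards2; case: (_ != _).
Qed.

Lemma available_seen c x k0 k1 :
    c x = None -> (forall k, seen c x k -> k = k0 \/ k = k1) ->
  exists k, available e c x k.
Proof.
move=> cx two; have [hx|] := boolP (heavy x); last exact: available_light.
by apply: (@available_heavy c x k0 k1) => k kN; apply: two; rewrite /seen cx hx.
Qed.

(** * How one coloring changes components and pairs *)

Section Recolor.
Variables (c : coloring) (u : T) (k : 'I_3).
Hypothesis cu : c u = None.
Notation c' := (recolor c u k).

Lemma recolor_None x : (c' x == None) = (x != u) && (c x == None).
Proof. by rewrite ffunE; case: (x == u). Qed.

Lemma recolor_link x y : link c' x y -> [&& link c x y, x != u & y != u].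
Proof.
rewrite /link !recolor_None => /and4P[-> /andP[-> ->] /andP[-> ->] ->].
by [].
Qed.

Lemma recolor_conn x y : conn c' x y -> conn c x y.
Proof.
by apply: connect_sub => a b /recolor_link/and3P[ab _ _]; apply: connect1.
Qed.

Lemma recolor_hh x y : hh c' x y -> [&& hh c x y, x != u & y != u].
Proof.
by rewrite /hh !recolor_None => /and5P[-> /andP[-> ->] /andP[-> ->] -> ->].
Qed.

(** A new pair is caused by [u]. Its vertex is heavy, so the edge to [u] was a link and the pair
    arises inside the old class of [u]. *)
Lemma recolor_seen x k1 : seen c' x k1 ->
  x != u /\ (seen c x k1 \/ [/\ k1 = k, e u x, heavy x & conn c u x]).
Proof.
rewrite /seen recolor_None => /and3P[/andP[xu cx] hx /availablePn[y exy]].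
rewrite ffunE => cy; split=> //; case: eqP cy => [yu [<-]|_ cy].
  right; rewrite -yu e_sym; split=> //.
  by apply: connect1; rewrite /link e_sym exy yu cu cx hx orbT.
by left; rewrite cx hx; apply/availablePn; exists y.
Qed.

(** No link passes through the colored [u], so the forest property applies. This is why a component
    gains at most one pair. *)
Lemma recolor_unique_neighbor x y : e u x -> e u y -> conn c' x y -> x = y.
Proof.
apply: forest_unique_neighbor => // a a'; first by case/and4P.
by case/recolor_link/and3P=> _ -> ->.
Qed.

(** Links and heavy-heavy edges can only disappear, and new pairs arise only in the class of [u]. *)
Lemma recolor_good_off r : ~~ conn c u r -> good c r -> good c' r.
Proof.
move=> ur; have far x : conn c' r x -> conn c r x /\ ~~ conn c u x.
  move=> /recolor_conn rx; split=> //; apply: contra ur => ux.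
  by apply: connect_trans ux _; rewrite -/(conn c x r) conn_sym.
have old x k1 : conn c' r x -> seen c' x k1 -> conn c r x /\ seen c x k1.
  by move=> /far[rx /negP ux] /recolor_seen[_ []// []].
case=> [[noh one]|[nos [v cov]]]; [left|right]; split.
- move=> x y /recolor_conn rx; apply: contra (noh x y rx).
  by case/recolor_hh/and3P.
- move=> x x' k1 k2 rx rx' /(old _ _ rx)[{}rx s] /(old _ _ rx')[{}rx' s'].
  exact: one s s'.
- move=> x k1 rx; apply/negP => /(old _ _ rx)[{}rx].
  exact/negP/nos.
- exists v => x y /recolor_conn rx /recolor_hh/and3P[xy _ _].
  exact: cov xy.
Qed.

Lemma recolor_tame_of_new r :
    (forall x y, conn c' r x -> ~~ hh c' x y) ->
    (forall x k1, conn c' r x -> seen c' x k1 -> k1 = k /\ e u x) ->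
  tame c' r.
Proof.
move=> noh new; split=> // x x' k1 k2 rx rx'.
move=> /(new _ _ rx)[-> ux] /(new _ _ rx')[-> ux']; split=> //.
apply: recolor_unique_neighbor ux ux' _.
by apply: connect_trans rx'; rewrite -/(conn c' x r) conn_sym.
Qed.

(** Coloring the covering vertex [u] destroys all heavy-heavy edges of its class. Old pairs at [u]
    vanish; old pairs of color [k] at neighbors of [u] coincide with new ones, which serves the
    reply that copies Bob's color. *)
Lemma recolor_tame_cover r : conn c u r ->
    (forall x y, conn c u x -> hh c x y -> u = x \/ u = y) ->
    (forall x k1, conn c u x -> seen c x k1 -> x = u \/ k1 = k /\ e u x) ->
  tame c' r.
Proof.
move=> ur cov old; apply: recolor_tame_of_new.
  move=> x y /recolor_conn rx; apply/negP=> /recolor_hh/and3P[xy xu yu].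
  have [xE|yE] := cov x y (connect_trans ur rx) xy.
    by rewrite xE eqxx in xu.
  by rewrite yE eqxx in yu.
move=> x k1 /recolor_conn rx /recolor_seen[/eqP xu].
case=> [/(old _ _ (connect_trans ur rx))[]//|[]//].
Qed.

(** Without uncolored heavy neighbors, [u] causes no pair, and the pairs at [u] vanish; so only
    those away from [u] count. *)
Lemma recolor_tame_single r : conn c u r ->
    (forall x y, conn c u x -> ~~ hh c x y) ->
    (forall x, e u x -> c x = None -> ~~ heavy x) ->
    (forall x x' k1 k2, conn c u x -> conn c u x' -> x != u -> x' != u ->
       seen c x k1 -> seen c x' k2 -> x = x' /\ k1 = k2) ->
  tame c' r.
Proof.
move=> ur noh noheavy one.
have old x k1 : conn c' r x -> seen c' x k1 ->
    [/\ conn c u x, x != u & seen c x k1].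
  move=> /recolor_conn rx sx; have [xu] := recolor_seen sx.
  case=> [|[_ ux hx _]]; first by split=> //; apply: connect_trans rx.
  have := noheavy x ux; rewrite hx.
  move: sx; rewrite /seen recolor_None => /andP[/andP[_ /eqP ->] _].
  by move=> /(_ erefl).
split=> [x y /recolor_conn rx|x x' k1 k2 rx rx'].
  apply: contra (noh x y (connect_trans ur rx)).
  by case/recolor_hh/and3P.
move=> /(old _ _ rx)[ux xu s] /(old _ _ rx')[ux' xu' s'].
exact: one s s'.
Qed.

Lemma recolor_covered r v : conn c u r ->
    (forall x y, conn c u x -> hh c x y -> v = x \/ v = y) ->
    (forall x, e u x -> c x = None -> ~~ heavy x) ->
    (forall x k1, conn c u x -> seen c x k1 -> x = u) ->
  covered c' r.
Proof.
move=> ur cov noheavy old; split; last first.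
  exists v => x y /recolor_conn rx /recolor_hh/and3P[xy _ _].
  exact: cov (connect_trans ur rx) xy.
move=> x k1 /recolor_conn rx; apply/negP=> sx.
have [/eqP xu] := recolor_seen sx.
case=> [/(old _ _ (connect_trans ur rx))//|[_ ux hx _]].
have := noheavy x ux; rewrite hx.
move: sx; rewrite /seen recolor_None => /andP[/andP[_ /eqP ->] _].
by move=> /(_ erefl).
Qed.

End Recolor.

(** * Legal moves and Alice's replies *)

Definition winning c := forall r, good c r.

Lemma winning_single c x k k' :
  winning c -> seen c x k -> seen c x k' -> k = k'.
Proof.
move=> win s s'; have [[_ one]|[nos _]] := win x.
  by have [] := one x x k k' (connect0 _ _) (connect0 _ _) s s'.
by have := nos x k (connect0 _ _); rewrite s.
Qed.

Lemma winning_available c x :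
  winning c -> c x = None -> exists k, available e c x k.
Proof.
move=> win cx.
have [/existsP[k0 s0]|/existsPn nos] := boolP [exists k, seen c x k].
  by apply: (@available_seen c x k0 k0) => // k /(winning_single win s0); left.
apply: (@available_seen c x ord0 ord0) => // k s.
by have := nos k; rewrite s.
Qed.

(** Before Bob's move a heavy vertex sees at most one color, afterwards at most two, so one of the
    three is left. *)
Lemma winning_recolor_available c u k x :
    winning c -> c u = None -> recolor c u k x = None ->
  exists k', available e (recolor c u k) x k'.
Proof.
move=> win cu cx.
have [/existsP[k0 s0]|/existsPn nos] := boolP [exists k, seen c x k].
  apply: (@available_seen _ x k0 k) => // k1 /(recolor_seen cu)[_].
  by case=> [/(winning_single win s0)|[]]; [left|right].
apply: (@available_seen _ x k k) => // k1 /(recolor_seen cu)[_].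
by case=> [s|[]]; [have := nos k1; rewrite s|left].
Qed.

Lemma not_stuck c :
  (forall x, c x = None -> exists k, available e c x k) -> ~~ stuck e c.
Proof.
move=> av; apply/existsPn => x; apply/negP => /andP[/eqP/av[k kx] /forallP/(_ k)].
by rewrite kx.
Qed.

Lemma winning_recolor c z k : c z = None ->
    (forall r, ~~ conn c z r -> good c r) ->
    (forall r, conn c z r -> good (recolor c z k) r) ->
  winning (recolor c z k).
Proof.
move=> cz off on r; have [|zr] := boolP (conn c z r); first exact: on.
exact: recolor_good_off (off r zr).
Qed.

Lemma winning_move c : winning c -> ~~ complete c ->
  exists z k, legal e c z k /\ winning (recolor c z k).
Proof.
move=> win /forallPn[w]; rewrite negbK => /eqP cw.
have play z : c z = None ->
    (forall k r, conn c z r -> good (recolor c z k) r) ->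
    exists z k, legal e c z k /\ winning (recolor c z k).
  move=> cz on; have [k kz] := winning_available win cz.
  exists z, k; split; first by rewrite /legal cz.
  by apply: winning_recolor => // r zr; apply: on.
have light_nbr z x : (forall x y, conn c w x -> ~~ hh c x y) ->
    conn c w z -> c z = None -> heavy z -> e z x -> c x = None -> ~~ heavy x.
  move=> noh wz cz hz zx cx; apply: contra (noh z x wz) => hx.
  by rewrite /hh zx cz cx hz hx.
have connw z x : conn c w z -> conn c z x -> conn c w x.
  exact: connect_trans.
have tame_play : tame c w ->
    exists z k, legal e c z k /\ winning (recolor c z k).
  case=> noh one.
  (* The choice is the vertex of the pair, else any heavy vertex, else [w]. None of these has an
     uncolored heavy neighbor. *)
  have [/existsP[x /existsP[k0 /andP[wx sx]]]|nos] :=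
      boolP [exists x, exists k, conn c w x && seen c x k].
    have /and3P[/eqP cx hx _] := sx.
    apply: (play x) => // k r xr; left; apply: recolor_tame_single => //.
    - by move=> x1 y /(connw _ _ wx)/noh.
    - by move=> y; apply: light_nbr.
    - move=> x1 x2 k1 k2 /(connw _ _ wx) wx1 /(connw _ _ wx) wx2 _ _.
      exact: one.
  have {}nos x k : conn c w x -> ~~ seen c x k.
    by move=> wx; have /existsPn/(_ k) := existsPn nos x; rewrite wx.
  have [/existsP[z /and3P[wz /eqP cz hz]]|noheavy] :=
      boolP [exists z, [&& conn c w z, c z == None & heavy z]].
    apply: (play z) => // k r zr; left; apply: recolor_tame_single => //.
    - by move=> x1 y /(connw _ _ wz)/noh.
    - by move=> y; apply: light_nbr.
    - by move=> x1 x2 k1 k2 /(connw _ _ wz) wx1 _ _ _; rewrite (negPf (nos _ _ wx1)).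
  apply: (play w) => // k r wr; left; apply: recolor_tame_single => //.
  - move=> x wx cx; apply: contra noheavy => hx; apply/existsP; exists x.
    by rewrite cx hx andbT eqxx andbT; apply: connect1; rewrite /link wx cw cx hx orbT.
  - by move=> x1 x2 k1 k2 wx1 _ _ _; rewrite (negPf (nos _ _ wx1)).
have [//|[nos [v cov]]] := win w.
(* Without heavy-heavy edges a covered class is tame; otherwise [v] is an endpoint of one, hence
   uncolored and in the class. *)
have [/existsP[x /existsP[y /andP[wx xy]]]|noh] :=
    boolP [exists x, exists y, conn c w x && hh c x y]; last first.
  apply: tame_play; split=> [x y wx|x x' k k' wx _].
    by have /existsPn/(_ y) := existsPn noh x; rewrite wx.
  by rewrite (negPf (nos _ _ wx)).
have [wv cv] : conn c w v /\ c v = None.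
  have /and5P[_ /eqP cx /eqP cy _ _] := xy.
  have [->|->] := cov x y wx xy; split=> //.
  exact: connw (hh_conn xy).
apply: (play v) => // k r vr; left; apply: recolor_tame_cover => //.
  by move=> x1 y1 /(connw _ _ wv); apply: cov.
by move=> x1 k1 /(connw _ _ wv) wx1; rewrite (negPf (nos _ _ wx1)).
Qed.

Lemma winning_reply c u k : winning c -> legal e c u k ->
    ~~ complete (recolor c u k) ->
  exists z k', legal e (recolor c u k) z k' /\
    winning (recolor (recolor c u k) z k').
Proof.
move=> win /andP[/eqP cu uk] c'N; set c' := recolor c u k.
have off r : ~~ conn c u r -> good c' r.
  by move=> ur; apply: recolor_good_off.
have free : (forall r, conn c u r -> good c' r) ->
    exists z k', legal e c' z k' /\ winning (recolor c' z k').
  by move=> on; apply: winning_move => //; apply: winning_recolor.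
have play z k' : c' z = None -> available e c' z k' ->
    (forall r, conn c u r -> ~~ conn c' z r -> good c' r) ->
    (forall r, conn c' z r -> good (recolor c' z k') r) ->
    exists z k', legal e c' z k' /\ winning (recolor c' z k').
  move=> c'z zk' others on; exists z, k'; split.
    by rewrite /legal zk' c'z.
  apply: winning_recolor => // r zr.
  by have [ur|/off//] := boolP (conn c u r); apply: others.
have connc' z x : c' z = None -> conn c u z -> conn c' z x -> conn c u x.
  by move=> c'z uz /recolor_conn; apply: connect_trans uz.
have c'E z : c' z = None -> z != u /\ c z = None.
  by move=> /eqP; rewrite recolor_None => /andP[-> /eqP].
have unique r x x' : conn c' r x -> conn c' r x' -> e u x -> e u x' -> x = x'.
  move=> rx rx' ux ux'; apply: (recolor_unique_neighbor ux ux').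
  by apply: connect_trans rx'; rewrite -/(conn c' x r) conn_sym.
have [[noh one]|[nos [v cov]]] := win u.
  have noh' r x y : conn c u r -> conn c' r x -> ~~ hh c' x y.
    move=> ur /recolor_conn rx; apply: contra (noh x y _).
      by case/recolor_hh/and3P.
    exact: connect_trans rx.
  (* If no old pair survives away from [u], all pairs are new and every component is tame. *)
  have [/existsP[x /existsP[k0 /and3P[ux xu sx]]]|nos] :=
      boolP [exists x, exists k0, [&& conn c u x, x != u & seen c x k0]];
    last first.
    apply: free => r ur; left; apply: recolor_tame_of_new => // [x y|x k1].
      exact: noh'.
    move=> /recolor_conn rx /(recolor_seen cu)[xu].
    case=> [s|[]//]; have /existsPn/(_ k1)/negP[] := existsPn nos x.
    by rewrite s xu (connect_trans ur rx : conn c u x).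
  have /and3P[/eqP cx hx _] := sx.
  have c'x : c' x = None by apply/eqP; rewrite recolor_None xu cx.
  have new x1 k1 : conn c u x1 -> x1 != x -> seen c' x1 k1 -> k1 = k /\ e u x1.
    move=> ux1 x1x /(recolor_seen cu)[_ [s|[]//]].
    by have [x1E] := one x1 x k1 k0 ux1 ux s sx; rewrite x1E eqxx in x1x.
  have [k' xk'] := winning_recolor_available win cu c'x.
  (* Coloring [x] removes the old pair; every other pair is caused by [u]. *)
  apply: (play x k') => // r.
    move=> ur xr; left; apply: recolor_tame_of_new => // [x1 y|x1 k1 rx1].
      exact: noh'.
    apply: new; first exact: connect_trans ur (recolor_conn rx1).
    by apply: contraNneq xr => <-; rewrite conn_sym.
  move=> xr; left; apply: recolor_tame_single => //.
  - by move=> x1 y; apply: noh'.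
  - move=> y xy c'y; apply: contra (noh x y ux) => hy.
    by have [_ cy] := c'E y c'y; rewrite /hh xy cx cy hx hy.
  - move=> x1 x2 k1 k2 xx1 xx2 x1x x2x.
    move=> /(new _ _ (connc' _ _ c'x ux xx1) x1x)[-> ux1].
    move=> /(new _ _ (connc' _ _ c'x ux xx2) x2x)[-> ux2].
    by split=> //; apply: (unique x).
have new x k1 : conn c u x -> seen c' x k1 -> k1 = k /\ e u x.
  by move=> ux /(recolor_seen cu)[_ [s|[]//]]; have := nos x k1 ux; rewrite s.
(* If Bob has colored the covering vertex, no heavy-heavy edge is left in its class. *)
have [uv|uv] := eqVneq u v.
  subst v; apply: free => r ur; left; apply: recolor_tame_cover => // x k1 ux.
  by rewrite (negPf (nos _ _ ux)).
have cov' r x y : conn c u r -> conn c' r x -> hh c' x y -> v = x \/ v = y.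
  move=> ur rx /recolor_hh/and3P[xy _ _]; apply: cov xy.
  exact: connect_trans ur (recolor_conn rx).
have new' r x k1 : conn c u r -> conn c' r x -> seen c' x k1 -> k1 = k /\ e u x.
  by move=> ur rx; apply: new; apply: connect_trans ur (recolor_conn rx).
(* A component that misses [v] has no heavy-heavy edge, and its pairs are all caused by [u]. *)
have others r : conn c u r ->
    (conn c' r v -> forall x y, conn c' r x -> ~~ hh c' x y) -> good c' r.
  move=> ur noh; left; apply: recolor_tame_of_new => //; last first.
    by move=> x k1; apply: new'.
  have [/noh//|rv] := boolP (conn c' r v) => x y rx.
  apply: contra rv => xy; have [->//|->] := cov' r x y ur rx xy.
  exact: connect_trans rx (hh_conn xy).
have others_off r : conn c u r -> ~~ conn c' v r -> good c' r.
  by move=> ur; rewrite conn_sym => /negP vr; apply: others.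
have [/existsP[y vy]|nohv] := boolP [exists y, hh c' v y]; last first.
  apply: free => r ur; apply: others => // rv x y rx; apply/negP => xy.
  have [vE|vE] := cov' r x y ur rx xy; subst v.
    by move/existsPn: nohv => /(_ y); rewrite xy.
  by move/existsPn: nohv => /(_ x); rewrite hh_sym xy.
have /and5P[_ /eqP c'v _ hv _] := vy.
have [_ cv] := c'E v c'v.
(* [cov] speaks only of the class of [u], so [v] may lie outside it. *)
have [uv'|uv'] := boolP (conn c u v); last first.
  apply: free => r ur; apply: others_off => //; apply: contra uv' => vr.
  apply: connect_trans ur _; rewrite -/(conn c r v) conn_sym.
  exact: recolor_conn vr.
have connv x : conn c' v x -> conn c u x by apply: connc'.
have covv x y1 : conn c' v x -> hh c' x y1 -> v = x \/ v = y1.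
  exact: cov'.
have [/existsP[x /existsP[k1 /andP[vx sx]]]|nos'] :=
    boolP [exists x, exists k1, conn c' v x && seen c' x k1]; last first.
  apply: free => r ur; have [vr|] := boolP (conn c' v r); last exact: others_off.
  right; split; last by exists v => x y1; apply: cov'.
  move=> x k1 rx; have /existsPn/(_ k1) := existsPn nos' x.
  by rewrite (connect_trans vr rx : conn c' v x).
have /and3P[/eqP c'x hx _] := sx.
have ux := connv _ vx.
have [_ eux] := new _ _ ux sx.
have only x1 k2 : conn c' v x1 -> seen c' x1 k2 -> k2 = k /\ x1 = x.
  move=> vx1 /(new _ _ (connv _ vx1))[-> ux1]; split=> //.
  exact: (unique v).
have [xv|xv] := eqVneq x v.
  have [k' vk'] := winning_recolor_available win cu c'v.
  apply: (play v k') => // r vr; left; apply: recolor_tame_cover => //.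
  by move=> x1 k2 vx1 /(only _ _ vx1)[_ ->]; left.
(* The color [k] is free at [v], as the only pair of the component sits at [x]. Giving it to [v]
   adds no second color at [x]. *)
have [vx'|vx'] := boolP (e v x).
  have vk : available e c' v k.
    apply: contraTT isT => vkN.
    have sv : seen c' v k by rewrite /seen c'v hv vkN.
    by have [_ vE] := only v k (connect0 _ _) sv; rewrite vE eqxx in xv.
  apply: (play v k) => // r vr; left; apply: recolor_tame_cover => //.
  by move=> x1 k2 vx1 /(only _ _ vx1)[-> ->]; right.
(* In this component an uncolored heavy neighbor of [x] could only be [v], which is not adjacent to
   [x]; so coloring [x] causes no pair and [v] still covers. *)
have [k' xk'] := winning_recolor_available win cu c'x.
have vx_trans r : conn c' x r -> conn c' v r by exact: connect_trans vx.
apply: (play x k') => // r.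
  move=> ur xr; apply: others_off => //; apply: contra xr => vr.
  by apply: connect_trans vr; rewrite -/(conn c' x v) conn_sym.
move=> xr; right; apply: (@recolor_covered _ _ _ c'x _ v) => //.
- by move=> x1 y1 /vx_trans; apply: covv.
- move=> z xz c'z; apply: contraNN vx' => hz.
  have xz' : hh c' x z by rewrite /hh xz c'x c'z hx hz.
  have [vE|->] := covv x z vx xz'; last by rewrite e_sym.
  by rewrite vE eqxx in xv.
- by move=> x1 k2 /vx_trans vx1 /(only _ _ vx1)[].
Qed.

Definition uncolored c : nat := #|[set x | c x == None]|.

Lemma uncolored_recolor c x k :
  c x = None -> uncolored (recolor c x k) < uncolored c.
Proof.
move=> cx; apply: proper_card; apply/properP; split.
  by apply/subsetP => y; rewrite !inE recolor_None => /andP[].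
by exists x; rewrite inE ?recolor_None ?cx // eqxx.
Qed.

(** Induction on the number of uncolored vertices, one round of two moves at a time. *)
Lemma winning_bob_loses c : winning c -> bob_loses_from e c.
Proof.
have [n] := ubnP (uncolored c); elim: n c => // n IHn c /ltnSE c_le win.
have [/BL_done//|cN] := boolP (complete c).
apply: BL_all; first by apply: not_stuck => x; apply: winning_available.
move=> u k uk; have /andP[/eqP cu _] := uk.
have [/AW_done//|c'N] := boolP (complete (recolor c u k)).
have [z [k' [zk' win']]] := winning_reply win uk c'N.
have /andP[/eqP c'z _] := zk'.
apply: AW_move zk' _.
  by apply: not_stuck => x; apply: winning_recolor_available.
apply: IHn win'; apply: leq_trans c_le.
exact: leq_ltn_trans (ltnW (uncolored_recolor _ c'z)) (uncolored_recolor _ cu).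
Qed.

End Strategy.

(* The trunk grown from an uncolored vertex [r].  It is built twice: in the graph
   itself, and in the reduced graph of the first-level trunks. *)
Section ComponentTrunk.
Variables (V : finType) (e : rel V) (col : {set V}) (r : V).
Hypotheses (e_sym : symmetric e) (rNcol : r \notin col).

Definition free_link : rel V :=
  fun x y => [&& e x y, x \notin col & y \notin col].

Definition component : {set V} := [set x | connect free_link r x].

(** Each edge has an endpoint in [component], which excludes edges between two colored vertices. *)
Definition component_trunk : {set V} * {set (V * V)} :=
  (component :|: [set x in col | [exists y in component, e x y]],
   [set a | e a.1 a.2 && ((a.1 \in component) || (a.2 \in component))]).

(** This makes colored vertices leaves. In the graph it follows from the forest property, in the
    reduced graph from colored copies being leaves already. *)
Hypothesis unique_neighbor : forall b x x', b \in col ->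
  x \in component -> x' \in component -> e b x -> e b x' -> x = x'.

Lemma component_root : r \in component.
Proof. by rewrite inE connect0. Qed.

Lemma component_free x : x \in component -> x \notin col.
Proof.
rewrite inE => /connectP[p pP ->]; elim: p r rNcol pP => //= y p IHp z _.
by case/andP=> /and3P[_ _ yN] /IHp; apply.
Qed.

Lemma component_step x y :
  x \in component -> e x y -> y \notin col -> y \in component.
Proof.
move=> xC exy yN; have xN := component_free xC; move: xC; rewrite !inE => rx.
by apply: connect_trans rx _; apply: connect1; rewrite /free_link exy xN.
Qed.

Lemma component_edge x y :
  x \in component -> e x y -> (x, y) \in component_trunk.2.
Proof. by move=> xC exy; rewrite inE /= exy xC. Qed.

Lemma component_edgeC x y :
  ((x, y) \in component_trunk.2) = ((y, x) \in component_trunk.2).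
Proof. by rewrite !inE /= e_sym orbC. Qed.

Lemma component_nbr x y :
  x \in component -> e x y -> y \in component_trunk.1.
Proof.
move=> xC exy; have [yc|yN] := boolP (y \in col).
  by rewrite !inE yc; apply/orP; right; apply/exists_inP; exists x; rewrite // e_sym.
by rewrite inE (component_step xC exy).
Qed.

Lemma component_trunkP : is_trunk e col component_trunk.
Proof.
have sub_edge x y : (x, y) \in component_trunk.2 -> e x y.
  by rewrite inE => /andP[].
have sub_vertex x y : (x, y) \in component_trunk.2 -> x \in component_trunk.1.
  move=> xy; have exy := sub_edge _ _ xy; move: xy; rewrite inE /= exy.
  case/orP=> [xC|yC]; first by rewrite inE xC.
  by apply: component_nbr yC _; rewrite e_sym.
have conn_root x : x \in component_trunk.1 ->
    connect (fun u v => (u, v) \in component_trunk.2) r x.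
  have reach y : y \in component ->
      connect (fun u v => (u, v) \in component_trunk.2) r y.
    rewrite inE => /connectP[p pP ->].
    elim/last_ind: p pP => [|p z IHp]; first by rewrite connect0.
    rewrite rcons_path last_rcons => /andP[pP yz].
    apply: connect_trans (IHp pP) (connect1 _).
    apply: component_edge; last by case/and3P: yz.
    by rewrite inE; apply/connectP; exists p.
  rewrite in_setU => /orP[/reach//|]; rewrite inE => /andP[_ /exists_inP[y yC xy]].
  apply: connect_trans (reach y yC) (connect1 _).
  by apply: component_edge; rewrite // e_sym.
have edge_col b x : b \in col -> (b, x) \in component_trunk.2 ->
    x \in component /\ e b x.
  move=> bc; rewrite inE /= => /andP[-> /orP[/component_free|//]].
  by rewrite bc.
have pre : pre_trunk e col component_trunk.
  apply/and4P; split.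
  - apply/forallP=> x; apply/forallP=> y; apply/implyP=> xy.
    rewrite (sub_edge _ _ xy) -component_edgeC xy (sub_vertex _ _ xy).
    by rewrite component_edgeC in xy; rewrite (sub_vertex _ _ xy).
  - by apply/set0Pn; exists r; rewrite inE component_root.
  - apply/forall_inP => x xV; apply/forall_inP => y yV.
    apply: connect_trans (conn_root y yV).
    rewrite sym_connect_sym; first exact: conn_root.
    exact: component_edgeC.
  - apply/forall_inP => b /setIP[]; rewrite in_setU => /orP[/component_free/negP//|].
    rewrite inE => /andP[bc /exists_inP[y yC eby]] _.
    rewrite /sdeg; suff -> : [set z | (b, z) \in component_trunk.2] = [set y].
      by rewrite cards1.
    apply/setP => z; rewrite inE in_set1; apply/idP/eqP => [|->].
      by case/(edge_col _ _ bc) => zC ebz; apply: unique_neighbor ebz eby.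
    by rewrite component_edgeC component_edge // e_sym.
rewrite /is_trunk pre; apply/forallP=> q; apply/implyP => /and3P[].
case/and4P=> /forallP q_sub _ q_conn /forall_inP q_deg sub1 sub2.
have {}q_sub x y : (x, y) \in q.2 -> [&& e x y, (y, x) \in q.2, x \in q.1 & y \in q.1].
  by move/forallP: (q_sub x) => /(_ y)/implyP.
(* Maximality: a larger pre-trunk [q] gains no edge at a component vertex, nor at a colored one,
   whose single edge in [q] already leads into the component. So paths of [q] from [r] stay
   inside. *)
have edge_q x y : x \in component_trunk.1 -> (x, y) \in q.2 ->
    (x, y) \in component_trunk.2.
  move=> xV xy; have /and4P[exy _ xq _] := q_sub _ _ xy.
  move: xV; rewrite in_setU => /orP[xC|]; first exact: component_edge.
  rewrite inE => /andP[xc /exists_inP[z zC exz]].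
  have xz : (x, z) \in component_trunk.2.
    by rewrite component_edgeC component_edge // e_sym.
  have x_col : x \in q.1 :&: col by rewrite inE xq.
  have /cards1P[w wE] := q_deg x x_col.
  have yw : y \in [set w] by rewrite -wE inE.
  have zw : z \in [set w] by rewrite -wE inE (subsetP sub2).
  by move: yw zw; rewrite !in_set1 => /eqP-> /eqP <-.
have vert_q : q.1 \subset component_trunk.1.
  apply/subsetP => x xq.
  have rq : r \in q.1 by rewrite (subsetP sub1) // inE component_root.
  move/forall_inP: q_conn => /(_ r rq)/forall_inP/(_ x xq)/connectP[p pP ->].
  have : r \in component_trunk.1 by rewrite inE component_root.
  elim: p (r) pP => //= z p IHp y /andP[yz /IHp{}IHp] yV; apply: IHp.
  by have := edge_q _ _ yV yz; rewrite component_edgeC; apply: sub_vertex.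
rewrite -pair_eqE /pair_eq !eqEsubset sub1 sub2 vert_q !andbT /=.
apply/subsetP => -[x y] xy; apply: edge_q (xy).
by apply: (subsetP vert_q); have /and4P[] := q_sub _ _ xy.
Qed.

End ComponentTrunk.

(** * From trunks of the reduced graph to the invariant after the opening *)

Section FirstMove.
Variables (T : finType) (e : rel T) (b r : T).
Hypotheses (e_sym : symmetric e) (e_forest : forest e).
Hypothesis rb : r != b.

Notation col := [set b].
Notation RT := (RV e col).
Notation C := (component e col r).
Notation c1 := (recolor [ffun _ : T => None] b (ord0 : 'I_3)).

Let p := component_trunk e col r.

Let rNcol : r \notin col.
Proof. by rewrite inE. Qed.

Lemma first_unique_neighbor x y :
  connect (free_link e col) x y -> e b x -> e b y -> x = y.
Proof.
move=> xy bx by_; apply: forest_unique_neighbor bx by_ xy => // a a'.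
  by case/and3P.
by rewrite /free_link !inE => /and3P[_ -> ->].
Qed.

Let pT : is_trunk e col p.
Proof.
apply: component_trunkP => // b' x x' /set1P-> xC x'C.
apply: first_unique_neighbor; move: xC x'C; rewrite !inE => rx.
apply: connect_trans; rewrite sym_connect_sym // => y z.
by rewrite /free_link e_sym [(y \notin _) && _]andbC.
Qed.


Lemma root_subproof : is_trunk e col p && (r \in p.1).
Proof. by rewrite pT inE component_root. Qed.

Definition root_copy : RT := exist _ (p, r) root_subproof.

(** Meaningful for vertices of the trunk [p]; elsewhere the default [root_copy] is returned. *)
Definition copy x : RT := insubd root_copy (p, x).

Lemma val_copy x : x \in p.1 -> val (copy x) = (p, x).
Proof. by move=> xV; rewrite val_insubd /= pT xV. Qed.

Lemma copy_root : copy r = root_copy.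
Proof. by apply: val_inj; rewrite val_copy // inE component_root. Qed.

Lemma copy_inj : {in p.1 &, injective copy}.
Proof.
by move=> x y xV yV /(congr1 val); rewrite !val_copy // => -[].
Qed.

Let sub_p x : x \in C -> x \in p.1.
Proof. by rewrite [x \in p.1]inE => ->. Qed.

Let nbr_p x y : x \in C -> e x y -> y \in p.1.
Proof. exact: component_nbr. Qed.

Lemma R_edge_sym : symmetric (R_edge e col).
Proof.
suff sub u v : R_edge e col u v -> R_edge e col v u.
  by move=> u v; apply/idP/idP; apply: sub.
case/andP=> /eqP uv uvE; rewrite /R_edge -uv eqxx /=.
have /andP[/andP[/and4P[/forallP sub _ _ _] _] _] := valP u.
by move/forallP: (sub (val u).2) => /(_ (val v).2)/implyP/(_ uvE)/and4P[].
Qed.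

Lemma R'_edge_sym : symmetric (R'_edge e col).
Proof. by move=> u v; rewrite /R'_edge /E_gt2 R_edge_sym orbC. Qed.

Lemma R_edge_copy x y : x \in C -> e x y -> R_edge e col (copy x) (copy y).
Proof.
move=> xC exy; rewrite /R_edge !val_copy ?eqxx //=; last exact: sub_p.
  exact: component_edge.
exact: nbr_p exy.
Qed.

(** An uncolored vertex keeps all its edges in its trunk, so its degree does not drop. *)
Lemma R_heavy_copy x : x \in C -> heavy e x -> 2 < deg (R_edge e col) (copy x).
Proof.
move=> xC hx; apply: leq_trans hx _; rewrite /deg.
rewrite -(@card_in_imset _ _ copy); last first.
  by move=> y z; rewrite !inE => xy xz; apply: copy_inj; apply: nbr_p xC _.
apply/subset_leq_card/subsetP => _ /imsetP[y xy ->].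
by rewrite inE in xy; rewrite inE R_edge_copy.
Qed.

Lemma R'_edge_copy x y : x \in C -> e x y -> heavy e x ->
  R'_edge e col (copy x) (copy y).
Proof.
by move=> xC exy hx; rewrite /R'_edge /E_gt2 R_edge_copy // R_heavy_copy.
Qed.

(** The reduction deletes no edge at a heavy vertex. *)
Lemma R'_heavy_copy x : x \in C -> heavy e x -> 2 < deg (R'_edge e col) (copy x).
Proof.
move=> xC hx; apply: leq_trans (R_heavy_copy xC hx) _.
apply/subset_leq_card/subsetP => u; rewrite !inE /R'_edge /E_gt2 => ->.
by rewrite R_heavy_copy.
Qed.

Lemma root_copy_free : root_copy \notin R_col e col.
Proof. by rewrite !inE. Qed.

(** A colored copy is a leaf of its trunk, and adjacent copies lie in the same trunk. *)
Lemma R_col_unique u v v' : u \in R_col e col ->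
  R'_edge e col u v -> R'_edge e col u v' -> v = v'.
Proof.
rewrite inE => uc /andP[/andP[/eqP uv uvE] _] /andP[/andP[/eqP uv' uvE'] _].
have /andP[/andP[/and4P[_ _ _ /forall_inP u_deg] _] u_in] := valP u.
have u_col : (val u).2 \in (val u).1.1 :&: col by rewrite inE u_in.
have /cards1P[w wE] := u_deg _ u_col.
have : (val v).2 \in [set w] by rewrite -wE inE.
have : (val v').2 \in [set w] by rewrite -wE inE.
rewrite !in_set1 => /eqP v'w /eqP vw; apply: val_inj.
by rewrite [val v]surjective_pairing [val v']surjective_pairing v'w vw -uv -uv'.
Qed.

Let P := component_trunk (R'_edge e col) (R_col e col) root_copy.

Let PT : is_trunk (R'_edge e col) (R_col e col) P.
Proof.
apply: component_trunkP; [exact: R'_edge_sym | exact: root_copy_free |].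
by move=> u v v' uc _ _; apply: R_col_unique.
Qed.

(** Every link has a heavy endpoint, so its copy survives the reduction and the class of [r] embeds
    in one reduced trunk. *)
Lemma conn_copy x : conn e c1 r x ->
  x \in C /\ copy x \in component (R'_edge e col) (R_col e col) root_copy.
Proof.
case/connectP=> q qP ->; elim/last_ind: q qP => [|q y IHq].
  by rewrite /= copy_root !component_root.
rewrite rcons_path last_rcons => /andP[/IHq].
move: (last r q) => {}x [xC xC'] /and4P[exy _].
rewrite recolor_None => /andP[yb _] heavy_xy.
have yC : y \in C by rewrite (component_step rNcol xC exy) // inE.
split=> //; apply: (component_step root_copy_free xC').
  case/orP: heavy_xy => [|hy]; first exact: R'_edge_copy.
  by rewrite R'_edge_sym R'_edge_copy // e_sym.
by rewrite !inE val_copy ?sub_p.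
Qed.

Lemma P_edge_copy x y : conn e c1 r x -> e x y -> heavy e x ->
  (copy x, copy y) \in P.2.
Proof.
by case/conn_copy=> xC xC' exy hx; apply: component_edge => //; apply: R'_edge_copy.
Qed.

Lemma P_sdeg_copy x : conn e c1 r x -> heavy e x -> 2 < sdeg P.2 (copy x).
Proof.
case/conn_copy=> xC xC' hx; apply: leq_trans (R'_heavy_copy xC hx) _.
apply/subset_leq_card/subsetP => u; rewrite inE => xu; rewrite inE.
exact: component_edge.
Qed.

Lemma first_seen x k : conn e c1 r x -> seen e c1 x k ->
  [/\ e b x, heavy e x & k = ord0].
Proof.
move=> rx /and3P[_ hx /availablePn[y exy]]; rewrite !ffunE.
by case: eqP exy => // -> exb [<-]; rewrite e_sym.
Qed.

Lemma first_good : reduced_trunks_ok e col -> good e c1 r.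
Proof.
have hh_conn_r x y : conn e c1 r x -> hh e c1 x y -> conn e c1 r y.
  by move=> rx /hh_conn; apply: connect_trans.
case/(_ P PT) => [[_ noh]|[nocol [v vP cov]]]; [left|right]; split.
- move=> x y rx; apply/negP=> xy; have ry := hh_conn_r _ _ rx xy.
  have /and5P[exy _ _ hx hy] := xy.
  have /negP[] := noh _ _ (P_edge_copy rx exy hx).
  have [[xC _] [yC _]] := (conn_copy rx, conn_copy ry).
  by rewrite /E_ggt2 R'_edge_copy // !R'_heavy_copy.
- move=> x x' k k' rx rx' /(first_seen rx)[bx _ ->] /(first_seen rx')[bx' _ ->].
  split=> //; have [[xC _] [x'C _]] := (conn_copy rx, conn_copy rx').
  apply: first_unique_neighbor bx bx'; move: xC x'C; rewrite !inE => xC.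
  apply: connect_trans; rewrite sym_connect_sym // => y z.
  by rewrite /free_link e_sym [(y \notin _) && _]andbC.
(* A heavy neighbor of [b] in the class would bring a colored copy of [b] into [P]. *)
- move=> x k rx; apply/negP=> /(first_seen rx)[bx hx _].
  have [xC xC'] := conn_copy rx.
  have exb : e x b by rewrite e_sym.
  have : copy b \in P.1 :&: R_col e col.
    apply/setIP; split; last by rewrite inE val_copy ?(nbr_p xC) // inE.
    exact: component_nbr R'_edge_sym root_copy_free _ _ xC' (R'_edge_copy xC exb hx).
  by rewrite nocol inE.
- exists (val v).2 => x y rx xy; have ry := hh_conn_r _ _ rx xy.
  have /and5P[exy _ _ hx hy] := xy.
  have [[xC _] [yC _]] := (conn_copy rx, conn_copy ry).
  have := cov _ _ (P_edge_copy rx exy hx) (P_sdeg_copy rx hx) (P_sdeg_copy ry hy).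
  by case/orP=> /eqP->; rewrite val_copy ?sub_p //; [left|right].
Qed.

End FirstMove.

Theorem theorem6p3 (T : finType) (e : rel T)
    (e_sym : symmetric e) (e_irr : irreflexive e) (F_forest : forest e) :
  (exists b : T, reduced_trunks_ok e [set b]) -> game_chromatic_le e 3.
Proof.
case=> b ok; exists 3 => //.
have allk v k : available e [ffun _ => None : option 'I_3] v k.
  by apply/forallP=> u; rewrite ffunE implybT.
apply: (@AW_move _ _ _ _ b ord0); last 1 first.
- apply: winning_bob_loses => // r.
  have [->|rb] := eqVneq r b; last exact: first_good.
  (* The colored [b] has no link, so its class is a singleton without pairs or heavy-heavy edges. *)
  left; have alone x : conn e (recolor [ffun _ => None] b (ord0 : 'I_3)) b x -> x = b.
    case/connectP=> -[|y q] //= /andP[/and4P[_]].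
    by rewrite recolor_None eqxx.
  by split=> [x y|x x' k k'] /alone->; rewrite /hh /seen recolor_None eqxx ?andbF.
- by apply: not_stuck => x _; exists ord0.
- by rewrite /legal ffunE eqxx allk.
Qed.
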